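(* Let $p$ be an odd prime and $r\ge1$ an integer. Let $A,B\subset(\mathbb{Z}/p^r\mathbb{Z})^2$, $P=A\times B$, and $R\subset\mathcal{R}_r$. Then \[\Big|\mathcal{I}(P,R)-\frac{|P||R|}{p^{2r}}\Big|\ll p^{\frac{3r-1}{2}}|P|^{1/2}|R|^{1/2}.\]
   Context: $G_r=SO_2(\mathbb{Z}/p^r\mathbb{Z})$ is the group of matrices $\begin{bmatrix}a&-b\\ b&a\end{bmatrix}$ with $a^2+b^2\equiv1\pmod{p^r}$. $\mathcal{R}_r=G_r\times(\mathbb{Z}/p^r\mathbb{Z})^2$ (rigid motions). For $P\subset(\mathbb{Z}/p^r\mathbb{Z})^2\times(\mathbb{Z}/p^r\mathbb{Z})^2$ and $R\subset\mathcal{R}_r$, $\mathcal{I}(P,R)$ is the number of pairs $((g,\mathbf{z}),(\mathbf{x},\mathbf{y}))\in R\times P$ with $g\mathbf{y}+\mathbf{z}=\mathbf{x}$. $X\ll Y$ means $X\le CY$ for an absolute constant $C$. *)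

(* Defs.v *)
From mathcomp Require Import all_boot all_order all_algebra.

Set Implicit Arguments.
Unset Strict Implicit.
Unset Printing Implicit Defensive.

Import GRing.Theory.
Local Open Scope ring_scope.

(* The ring of integers mod n is 'Z_n, which is the intended one only for
   n > 1; below n is p ^ r with p prime and r >= 1. *)

Definition rot_mx (n : nat) (a b : 'Z_n) : 'M['Z_n]_2 :=
  \matrix_(i < 2, j < 2)
    if i == j then a else if i == ord0 then - b else b.

Definition SO2 (n : nat) : {set 'M['Z_n]_2} :=
  [set rot_mx ab.1 ab.2 | ab : 'Z_n * 'Z_n & ab.1 ^+ 2 + ab.2 ^+ 2 == 1].

Definition rigid_motions (n : nat) : {set 'M['Z_n]_2 * 'cV['Z_n]_2} :=
  setX (SO2 n) [set: 'cV['Z_n]_2].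

Definition incidences (n : nat) (P : {set 'cV['Z_n]_2 * 'cV['Z_n]_2})
    (M : {set 'M['Z_n]_2 * 'cV['Z_n]_2}) : nat :=
  #|[set q in setX M P |
      let: ((g, z), (x, y)) := q in g *m y + z == x]|.

(* Main.v *)
(* Write [q = p ^ r].  For [f = q^2 1_A - |A|], the number of incidences on a
   motion [(g, z)], scaled by [q^2] and recentred, is the correlation
   [sum_y f (g y + z) 1_B y], whose Fourier transform in [z] at [xi] is
   [f^ xi * conj (1_B^ (g^T xi))].  For [xi <> 0], two rotations with the same
   value of [g^T xi] agree modulo [p], so at most [p ^ (r - 1)] rotations share
   that value; Plancherel then bounds the sum of the squared correlations over
   all rigid motions by [q^6 p^(r-1) |A| |B|], and Cauchy-Schwarz over the given
   motions yields the theorem with constant 1. *)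
Require Import Defs.
From mathcomp Require Import all_boot all_order all_algebra all_field.
From mathcomp Require Import reals exp.
From mathcomp Require Import ring lra.

Set Implicit Arguments.
Unset Strict Implicit.
Unset Printing Implicit Defensive.

Import Order.TTheory GRing.Theory Num.Theory.
Local Open Scope ring_scope.

(** * Fourier analysis on [(Z/n)^m] *)

Section Fourier.

Variables (n m : nat) (w : algC).
Hypotheses (n_gt1 : (1 < n)%N) (prim_w : n.-primitive_root w).

Local Notation V := 'cV['Z_n]_m.

(** The exponent is the representative of [t] in [nat]; since [w] has order exactly [n], this gives
    a faithful additive character. *)
Definition zchar (t : 'Z_n) : algC := w ^+ t.

Lemma zcharD s t : zchar (s + t) = zchar s * zchar t.
Proof.
have expr_modq k : w ^+ (k %% (Zp_trunc n).+2) = w ^+ k.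
  by rewrite Zp_cast // (prim_expr_mod prim_w).
by rewrite /zchar expr_modq exprD.
Qed.

Lemma zchar0 : zchar 0 = 1. Proof. by []. Qed.

Lemma zchar_eq1 t : (zchar t == 1) = (t == 0).
Proof.
rewrite /zchar -(prim_order_dvd prim_w) /dvdn modn_small //.
by have := ltn_ord t; rewrite {2}Zp_cast.
Qed.

Lemma zchar_conj t : (zchar t)^* = zchar (- t).
Proof.
have norm_w : `|zchar t| = 1.
  apply/eqP; rewrite -(pexpr_eq1 (n := n)) ?(ltnW n_gt1) // -normrX.
  by rewrite exprAC (prim_expr_order prim_w) expr1n normr1.
have : zchar t != 0 by rewrite -normr_eq0 norm_w oner_eq0.
move/mulfI; apply; rewrite -zcharD subrr zchar0 -normCK norm_w.
by rewrite expr1n.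
Qed.

Definition dotv (x y : V) : 'Z_n := (x^T *m y) ord0 ord0.

Lemma dotvDl x y z : dotv (x + y) z = dotv x z + dotv y z.
Proof. by rewrite /dotv linearD mulmxDl mxE. Qed.

Lemma dotvDr x y z : dotv x (y + z) = dotv x y + dotv x z.
Proof. by rewrite /dotv mulmxDr mxE. Qed.

Lemma dotvNr x y : dotv x (- y) = - dotv x y.
Proof. by rewrite /dotv mulmxN mxE. Qed.

Lemma dotv0r x : dotv x 0 = 0.
Proof. by rewrite /dotv mulmx0 mxE. Qed.

Lemma dotv0l x : dotv 0 x = 0.
Proof. by rewrite /dotv linear0 mul0mx mxE. Qed.

Lemma dotv_mulmxr (g : 'M_m) x y : dotv x (g *m y) = dotv (g^T *m x) y.
Proof. by rewrite /dotv trmx_mul trmxK mulmxA. Qed.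

Lemma card_cV_Zp : #|{: V}| = (n ^ m)%N.
Proof. by rewrite card_mx card_ord muln1 Zp_cast. Qed.

Lemma sum_zchar_dotv (x : V) :
  \sum_(xi : V) zchar (dotv xi x) = (n ^ m)%:R * (x == 0)%:R.
Proof.
have [->|x_neq0] := eqVneq x 0.
  under eq_bigr do rewrite dotv0r zchar0.
  by rewrite sumr_const card_cV_Zp mulr1.
rewrite mulr0.
have [i xi_neq0] : exists i, x i ord0 != 0.
  apply/existsP; apply: contraNT x_neq0 => /existsPn x0.
  apply/eqP/matrixP => i j; rewrite (ord1 j) mxE.
  by apply/eqP; rewrite -[_ == _]negbK x0.
(* Translating the frequency by [y] multiplies the sum by [zchar (x i ord0)], which is not 1, so the
   sum vanishes. *)
pose y : V := delta_mx i ord0.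
have dot_y : dotv y x = x i ord0.
  by rewrite /dotv trmx_delta -rowE mxE.
set S := (LHS); have : S = zchar (x i ord0) * S.
  rewrite {1}/S (reindex_inj (addrI y)) mulr_sumr.
  by apply: eq_bigr => xi _; rewrite dotvDl zcharD dot_y.
move/eqP; rewrite -subr_eq0 -{1}[S]mul1r -mulrBl mulf_eq0 subr_eq0 eq_sym.
by rewrite zchar_eq1 (negPf xi_neq0) => /eqP.
Qed.

Definition fourier (f : V -> algC) (xi : V) : algC :=
  \sum_x f x * zchar (dotv xi x).

Lemma plancherel (f : V -> algC) :
  \sum_xi `|fourier f xi| ^+ 2 = (n ^ m)%:R * \sum_x `|f x| ^+ 2.
Proof.
transitivity (\sum_xi \sum_x \sum_y
    f x * (f y)^* * zchar (dotv xi (x - y))).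
  apply: eq_bigr => xi _; rewrite normCK /fourier rmorph_sum mulr_suml.
  apply: eq_bigr => x _; rewrite mulr_sumr; apply: eq_bigr => y _.
  by rewrite rmorphM /= zchar_conj dotvDr dotvNr zcharD mulrACA.
rewrite exchange_big mulr_sumr; apply: eq_bigr => x _ /=.
rewrite exchange_big (bigD1 x) //= [X in _ + X]big1 => [|y y_neq].
  by rewrite addr0 -mulr_sumr sum_zchar_dotv subrr eqxx mulr1 mulrC normCK.
by rewrite -mulr_sumr sum_zchar_dotv subr_eq0 eq_sym (negPf y_neq) !mulr0.
Qed.

(** Substituting [z = x - g *m y] separates the sums over [x] and [y]; the transpose moves [g] onto
    the frequency, and the sign in front of [y] becomes a conjugate because [h] is real. *)
Lemma fourier_correlation (f h : V -> algC) (g : 'M['Z_n]_m) xi :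
    (forall y, h y \is Num.real) ->
  fourier (fun z => \sum_y f (g *m y + z) * h y) xi
    = fourier f xi * (fourier h (g^T *m xi))^*.
Proof.
move=> h_real; rewrite /fourier.
under eq_bigr do rewrite mulr_suml.
rewrite exchange_big rmorph_sum mulr_sumr; apply: eq_bigr => y _ /=.
rewrite (reindex_inj (addrI (- (g *m y)))) mulr_suml; apply: eq_bigr => x _ /=.
rewrite rmorphM /= zchar_conj (CrealP (h_real y)) addrA subrr add0r.
by rewrite dotvDr zcharD dotvNr dotv_mulmxr; ring.
Qed.

(* Only nonzero frequencies matter since [f] has mean zero; a bound on the
   fibres of [g |-> g^T *m xi] turns the sum over [G] into Plancherel sums. *)
Lemma sum_correlation_le (G : {set 'M['Z_n]_m}) (k : nat) (f h : V -> algC) :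
    (forall xi eta : V, xi != 0 ->
       (#|[set g in G | g^T *m xi == eta]| <= k)%N) ->
    (forall y, h y \is Num.real) -> \sum_x f x = 0 ->
  \sum_(g in G) \sum_z `|\sum_y f (g *m y + z) * h y| ^+ 2
    <= (n ^ m * k)%:R * (\sum_x `|f x| ^+ 2) * (\sum_y `|h y| ^+ 2).
Proof.
move=> fibre_le h_real sum_f.
have q_gt0 : 0 < (n ^ m)%:R :> algC.
  by rewrite ltr0n expn_gt0 (ltnW n_gt1).
rewrite -(ler_pM2l q_gt0) [leLHS]mulr_sumr.
have -> : \sum_(g in G) (n ^ m)%:R
            * \sum_z `|\sum_y f (g *m y + z) * h y| ^+ 2
          = \sum_xi \sum_(g in G)
              `|fourier f xi| ^+ 2 * `|fourier h (g^T *m xi)| ^+ 2.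
  rewrite exchange_big; apply: eq_bigr => g _.
  rewrite -plancherel; apply: eq_bigr => xi _.
  by rewrite fourier_correlation // normrM norm_conjC exprMn.
have -> : (n ^ m)%:R * ((n ^ m * k)%:R * (\sum_x `|f x| ^+ 2)
            * (\sum_y `|h y| ^+ 2))
    = \sum_xi `|fourier f xi| ^+ 2
        * (k%:R * ((n ^ m)%:R * \sum_y `|h y| ^+ 2)).
  by rewrite -mulr_suml plancherel natrM; ring.
apply: ler_sum => xi _; rewrite -mulr_sumr.
have [->|xi_neq0] := eqVneq xi 0.
  have -> : fourier f 0 = 0.
    by rewrite -[RHS]sum_f; apply: eq_bigr => x _; rewrite dotv0l zchar0 mulr1.
  by rewrite normr0 expr0n !mul0r.
apply: ler_wpM2l; first by rewrite exprn_ge0.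
rewrite -plancherel (partition_big (fun g : 'M_m => g^T *m xi) xpredT) //=.
rewrite mulr_sumr; apply: ler_sum => eta _.
rewrite (eq_bigr (fun=> `|fourier h eta| ^+ 2)); last first.
  by move=> g /andP[_ /eqP->].
rewrite big_const iter_addr_0 -[leLHS]mulr_natl ler_wpM2r ?exprn_ge0 // ler_nat.
by have := fibre_le xi eta xi_neq0; rewrite cardsE.
Qed.

End Fourier.

(** Isotropic vectors can be nonzero here, so the circle equations are essential: they force the
    inner product of the two points to be 1, hence their determinant to be 0 by Lagrange's identity,
    and these two values recover one point from the other. *)
Lemma unit_circle_isotropic_eq (F : fieldType) (a b a' b' : F) :
    2 != 0 :> F -> a ^+ 2 + b ^+ 2 = 1 -> a' ^+ 2 + b' ^+ 2 = 1 ->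
    (a - a') ^+ 2 + (b - b') ^+ 2 = 0 ->
  a = a' /\ b = b'.
Proof.
move=> two_neq0 ab1 ab1' dist0.
have inner1 : a * a' + b * b' = 1.
  apply: (mulfI two_neq0); apply/eqP; rewrite -subr_eq0.
  have -> : 2 * (a * a' + b * b') - 2 * 1
      = (a ^+ 2 + b ^+ 2 - 1) + (a' ^+ 2 + b' ^+ 2 - 1)
        - ((a - a') ^+ 2 + (b - b') ^+ 2) by ring.
  by rewrite ab1 ab1' dist0 !subrr addr0 subr0.
have outer0 : a * b' - a' * b = 0.
  apply/eqP; rewrite -sqrf_eq0.
  have -> : (a * b' - a' * b) ^+ 2
      = (a ^+ 2 + b ^+ 2) * (a' ^+ 2 + b' ^+ 2)
        - (a * a' + b * b') ^+ 2 by ring.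
  by rewrite ab1 ab1' inner1 mulr1 expr1n subrr.
split.
  have -> : a' = a' * (a ^+ 2 + b ^+ 2) by rewrite ab1 mulr1.
  have -> : a' * (a ^+ 2 + b ^+ 2)
      = a * (a * a' + b * b') - b * (a * b' - a' * b) by ring.
  by rewrite inner1 outer0 mulr1 mulr0 subr0.
have -> : b' = b' * (a ^+ 2 + b ^+ 2) by rewrite ab1 mulr1.
have -> : b' * (a ^+ 2 + b ^+ 2)
    = b * (a * a' + b * b') + a * (a * b' - a' * b) by ring.
by rewrite inner1 outer0 mulr1 mulr0 addr0.
Qed.

(** * Reduction modulo [p] and rotations with a common value at a nonzero vector *)

Section Fibres.

Variables p r : nat.
Hypotheses (p_prime : prime p) (p_odd : odd p) (r_gt0 : (0 < r)%N).

Local Notation q := (p ^ r)%N.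

Lemma prime_exp_gt1 : (1 < q)%N.
Proof. by rewrite -(exp1n r) ltn_exp2r ?prime_gt1. Qed.

Definition redp (x : 'Z_q) : 'F_p := (x : nat)%:R.

Lemma natr_modq (k : nat) : (k %% q)%:R = k%:R :> 'F_p.
Proof.
rewrite [in RHS](divn_eq k q) natrD natrM natrX.
by rewrite pchar_Fp_0 // expr0n eqn0Ngt r_gt0 mulr0 add0r.
Qed.

Lemma redp_nat (k : nat) : redp k%:R = k%:R.
Proof. by rewrite /redp val_Zp_nat ?prime_exp_gt1 // natr_modq. Qed.

Lemma redpD x y : redp (x + y) = redp x + redp y.
Proof. by rewrite -[x]natr_Zp -[y]natr_Zp -natrD !redp_nat natrD. Qed.

Lemma redpM x y : redp (x * y) = redp x * redp y.
Proof. by rewrite -[x]natr_Zp -[y]natr_Zp -natrM !redp_nat natrM. Qed.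

Lemma redp1 : redp 1 = 1. Proof. exact: (redp_nat 1). Qed.

Lemma redpN x : redp (- x) = - redp x.
Proof. by apply/eqP; rewrite -addr_eq0 -redpD addNr (redp_nat 0). Qed.

Lemma redp_unit x : redp x != 0 -> x \is a GRing.unit.
Proof.
rewrite /redp -(dvdn_pcharf (pchar_Fp p_prime)) -[in X in _ -> X](natr_Zp x).
rewrite unitZpE ?prime_exp_gt1 // -prime_coprime //.
exact: coprimeXl.
Qed.

Lemma redp2_neq0 : 2 != 0 :> 'F_p.
Proof.
rewrite -(dvdn_pcharf (pchar_Fp p_prime)) dvdn_prime2 //.
by apply: contraTneq p_odd => ->.
Qed.

(** Once its residue modulo [p] is fixed, a representative below [p ^ r] is determined by its
    quotient by [p], which is below [p ^ r.-1]. *)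
Lemma card_redp_fibre (c : 'F_p) :
  (#|[set x | redp x == c]| <= p ^ r.-1)%N.
Proof.
have p_gt0 := prime_gt0 p_prime.
have lt_div (x : 'Z_q) : (x %/ p < p ^ r.-1)%N.
  rewrite ltn_divLR // -expnSr prednK //.
  by have := ltn_ord x; rewrite {2}Zp_cast ?prime_exp_gt1.
rewrite -[leqRHS]card_ord -(card_in_imset (f := fun x => Ordinal (lt_div x))).
  exact: max_card.
move=> x y; rewrite !inE => /eqP rx /eqP ry [eq_div].
apply: val_inj; rewrite /= (divn_eq x p) (divn_eq y p) eq_div; congr (_ + _)%N.
by rewrite -!(val_Fp_nat p_prime) -!/(redp _) rx ry.
Qed.

Lemma rot_mx_tr_mul (a b : 'Z_q) (x : 'cV_2) :
  (((rot_mx a b)^T *m x) ord0 ord0 = a * x ord0 ord0 + b * x ord_max ord0) *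
  (((rot_mx a b)^T *m x) ord_max ord0 = a * x ord_max ord0 - b * x ord0 ord0).
Proof.
have ord0E : widen_ord (leqnSn 1) ord_max = ord0 :> 'I_2 by exact: val_inj.
by split; rewrite mxE !big_ord_recr big_ord0 /= !mxE /= ord0E; ring.
Qed.

(* The matrix [g - g'] kills [xi <> 0], so its determinant
   [(a - a')^2 + (b - b')^2] is not a unit. *)
Lemma redp_rot_mx_eq (a b a' b' : 'Z_q) (xi : 'cV_2) :
    a ^+ 2 + b ^+ 2 = 1 -> a' ^+ 2 + b' ^+ 2 = 1 -> xi != 0 ->
    (rot_mx a b)^T *m xi = (rot_mx a' b')^T *m xi ->
  redp a = redp a' /\ redp b = redp b'.
Proof.
move=> ab1 ab1' xi_neq0 eq_rot.
have redp_circle u v : u ^+ 2 + v ^+ 2 = 1 -> redp u ^+ 2 + redp v ^+ 2 = 1.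
  by rewrite !expr2 -!redpM -redpD => ->; exact: redp1.
apply: unit_circle_isotropic_eq redp2_neq0 (redp_circle _ _ ab1)
  (redp_circle _ _ ab1') _.
apply/eqP; rewrite -!redpN -!redpD !expr2 -!redpM -redpD.
apply: contraNT xi_neq0 => /redp_unit det_unit.
have eq0 : a * xi ord0 ord0 + b * xi ord_max ord0
    = a' * xi ord0 ord0 + b' * xi ord_max ord0.
  by rewrite -!rot_mx_tr_mul eq_rot.
have eq1 : a * xi ord_max ord0 - b * xi ord0 ord0
    = a' * xi ord_max ord0 - b' * xi ord0 ord0.
  by rewrite -!rot_mx_tr_mul eq_rot.
move/eqP: eq0; rewrite -subr_eq0 => /eqP eq0.
move/eqP: eq1; rewrite -subr_eq0 => /eqP eq1.
apply/eqP/matrixP => i j; rewrite (ord1 j) mxE.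
(* The combinations of [eq0] and [eq1] below are the rows of the adjugate of the transpose of
   [g - g']; each yields the determinant times one coordinate of [xi]. *)
apply: (mulrI det_unit); rewrite mulr0.
have [-> | ->] : i = ord0 \/ i = ord_max.
- by case: i => [[|[|//]]] ?; [left | right]; exact: val_inj.
- transitivity ((a - a') * (a * xi ord0 ord0 + b * xi ord_max ord0
      - (a' * xi ord0 ord0 + b' * xi ord_max ord0))
    - (b - b') * (a * xi ord_max ord0 - b * xi ord0 ord0
      - (a' * xi ord_max ord0 - b' * xi ord0 ord0))); first by ring.
  by rewrite eq0 eq1 !mulr0 subrr.
transitivity ((b - b') * (a * xi ord0 ord0 + b * xi ord_max ord0
      - (a' * xi ord0 ord0 + b' * xi ord_max ord0))
    + (a - a') * (a * xi ord_max ord0 - b * xi ord0 ord0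
      - (a' * xi ord_max ord0 - b' * xi ord0 ord0))); first by ring.
by rewrite eq0 eq1 !mulr0 addr0.
Qed.

(** In [(x - y) * (x + y) = 0] the second factor reduces to twice [redp y], so it is a unit for odd
    [p]. *)
Lemma sqr_inj_redp (x y : 'Z_q) :
  redp x = redp y -> redp y != 0 -> x ^+ 2 = y ^+ 2 -> x = y.
Proof.
move=> rxy ry_neq0 /eqP; rewrite -subr_eq0 subr_sqr => /eqP prod0.
have sum_unit : x + y \is a GRing.unit.
  by apply: redp_unit; rewrite redpD rxy -mulr2n -mulr_natl mulf_neq0 ?redp2_neq0.
by apply/eqP; rewrite -subr_eq0; apply/eqP/(mulIr sum_unit); rewrite mul0r.
Qed.

(** Both entries are fixed modulo [p], which alone would allow [p ^ (2 * r.-1)] pairs. The circle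
    equation saves a factor [p ^ r.-1]: an entry that is nonzero modulo [p] is determined by the
    other one. *)
Lemma card_SO2_fibre (xi eta : 'cV['Z_q]_2) : xi != 0 ->
  (#|[set g in SO2 q | g^T *m xi == eta]| <= p ^ r.-1)%N.
Proof.
move=> xi_neq0; set D := [set g in _ | _].
have [-> | [g0 g0D]] := set_0Vmem D; first by rewrite cards0.
have DP g : g \in D ->
    exists a b, [/\ g = rot_mx a b, a ^+ 2 + b ^+ 2 = 1
      & (rot_mx a b)^T *m xi = eta].
  rewrite inE => /andP[/imsetP[[a b] + ->] /eqP] /=.
  by rewrite inE => /eqP; exists a, b.
have [a0 [b0 [_ ab0 eta0]]] := DP _ g0D.
have redD a b : a ^+ 2 + b ^+ 2 = 1 -> (rot_mx a b)^T *m xi = eta ->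
    redp a = redp a0 /\ redp b = redp b0.
  by move=> ab1 eta1; apply: redp_rot_mx_eq xi_neq0 _ => //; rewrite eta1.
have [ra0 | ra0] := eqVneq (redp a0) 0.
  have rb0 : redp b0 != 0.
    apply: contra_eq_neq (redp1) => rb0; rewrite -ab0 redpD !expr2 !redpM.
    by rewrite ra0 rb0 mulr0 addr0 eq_sym oner_eq0.
  (* Here [b] is nonzero modulo [p], so rotations of the fibre are counted by their entry [a]. *)
  apply: leq_trans (card_redp_fibre (redp a0)).
  rewrite -(card_in_imset (f := fun g : 'M['Z_q]_2 => g ord0 ord0)).
    apply/subset_leq_card/subsetP => _ /imsetP[g gD ->].
    have [a [b [-> ab1 /(redD _ _ ab1)[ra _]]]] := DP _ gD.
    by rewrite inE mxE /= ra.
  move=> g g' gD g'D; have [a [b [-> ab1 eab]]] := DP _ gD.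
  have [a' [b' [-> ab1' eab']]] := DP _ g'D; rewrite !mxE /= => eq_a.
  have [_ rb] := redD _ _ ab1 eab; have [_ rb'] := redD _ _ ab1' eab'.
  rewrite eq_a in ab1 *; congr rot_mx; apply: sqr_inj_redp.
  - by rewrite rb rb'.
  - by rewrite rb'.
  - by apply: (addrI (a' ^+ 2)); rewrite ab1.
(* Symmetrically, [a] is nonzero modulo [p] and the entry [b] determines the rotation. *)
apply: leq_trans (card_redp_fibre (redp b0)).
rewrite -(card_in_imset (f := fun g : 'M['Z_q]_2 => g ord_max ord0)).
  apply/subset_leq_card/subsetP => _ /imsetP[g gD ->].
  have [a [b [-> ab1 /(redD _ _ ab1)[_ rb]]]] := DP _ gD.
  by rewrite inE mxE /= rb.
move=> g g' gD g'D; have [a [b [-> ab1 eab]]] := DP _ gD.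
have [a' [b' [-> ab1' eab']]] := DP _ g'D; rewrite !mxE /= => eq_b.
have [ra _] := redD _ _ ab1 eab; have [ra' _] := redD _ _ ab1' eab'.
rewrite eq_b in ab1 *; congr rot_mx; apply: sqr_inj_redp.
- by rewrite ra ra'.
- by rewrite ra'.
- by apply: (addIr (b' ^+ 2)); rewrite ab1.
Qed.

End Fibres.

(** Cauchy-Schwarz against the constant 1: the sum of [(F i - F j) ^+ 2] over all pairs is twice the
    difference of the two sides. *)
Lemma sqr_sum_le_card (R : realDomainType) (I : finType) (S : {set I})
    (F : I -> R) :
  (\sum_(i in S) F i) ^+ 2 <= #|S|%:R * \sum_(i in S) F i ^+ 2.
Proof.
set s := \sum_(i in S) F i; set t := \sum_(i in S) F i ^+ 2.
have : 0 <= \sum_(i in S) \sum_(j in S) (F i - F j) ^+ 2.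
  by apply: sumr_ge0 => i _; apply: sumr_ge0 => j _; exact: sqr_ge0.
have -> : \sum_(i in S) \sum_(j in S) (F i - F j) ^+ 2
    = \sum_(i in S) (#|S|%:R * F i ^+ 2 - 2 * s * F i + t).
  apply: eq_bigr => i _; rewrite /s /t mulrAC mulr_sumr mulr_natl -sumr_const.
  rewrite -sumrB -big_split; apply: eq_bigr => j _ /=; ring.
rewrite big_split sumrB /= -!mulr_sumr -/s -/t sumr_const -mulr_natl => ?.
lra.
Qed.

(** * Second moment of the incidence counts *)

Section Incidences.

Variables p r : nat.
Hypotheses (p_prime : prime p) (p_odd : odd p) (r_gt0 : (0 < r)%N).

Local Notation q := (p ^ r)%N.
Local Notation V := 'cV['Z_q]_2.

Definition motion_hits (A B : {set V}) (g : 'M['Z_q]_2) (z : V) : nat :=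
  #|[set y in B | g *m y + z \in A]|.

Lemma incidences_sum (A B : {set V}) (M : {set 'M['Z_q]_2 * V}) :
  incidences (setX A B) M = (\sum_(m in M) motion_hits A B m.1 m.2)%N.
Proof.
rewrite /incidences -sum1_card.
rewrite (partition_big fst [in M]) /=; last first.
  by case=> [[g z] [x y]]; rewrite !inE => /andP[/andP[]].
apply: eq_bigr => -[g z] gzM; rewrite /motion_hits -sum1_card.
(* For a fixed motion, an incident pair is determined by its second point [y]. *)
rewrite (reindex_onto (fun y => ((g, z), (g *m y + z, y))) (fun m => m.2.2)).
  apply: eq_bigl => y; rewrite !inE !eqxx /= gzM /= !andbT.
  by rewrite andbC.
by case=> [[g' z'] [x y]]; rewrite !inE => /andP[/andP[_ /eqP <-] /eqP[-> ->]].
Qed.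

(** Scaling by [q ^ 2] keeps the deviation from the mean an integer, so that a bound proved in
    [algC] transfers to the reals. *)
Definition excess (A B : {set V}) (m : 'M['Z_q]_2 * V) : int :=
  (q ^ 2 * motion_hits A B m.1 m.2)%:R - (#|A| * #|B|)%:R.

Lemma sum_excess_sqr_le (A B : {set V}) :
  \sum_(m in rigid_motions q) excess A B m ^+ 2
    <= (q ^ 6 * p ^ r.-1 * (#|A| * #|B|))%:R.
Proof.
have q_gt1 := prime_exp_gt1 p_prime r_gt0.
have [w prim_w] := C_prim_root_exists (ltnW q_gt1).
pose f (x : V) : algC := (q ^ 2)%:R * (x \in A)%:R - #|A|%:R.
pose h (y : V) : algC := (y \in B)%:R.
have sum_ind (S : {set V}) : \sum_x (x \in S)%:R = #|S|%:R :> algC.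
  rewrite -sum1_card natr_sum [RHS]big_mkcond /=.
  by apply: eq_bigr => x _; case: (x \in S).
have sum_f : \sum_x f x = 0.
  rewrite sumrB -mulr_sumr sum_ind sumr_const card_cV_Zp //.
  by rewrite mulr_natl subrr.
have h_real y : h y \is Num.real by rewrite realn.
have := sum_correlation_le q_gt1 prim_w
  (@card_SO2_fibre _ _ p_prime p_odd r_gt0) h_real sum_f.
have -> : \sum_y `|h y| ^+ 2 = #|B|%:R.
  rewrite -sum_ind; apply: eq_bigr => y _.
  by rewrite normr_nat -natrX /h; case: (y \in B).
(* One factor of [f x ^+ 2] is expanded; the part [#|A|%:R * f x] sums to 0, and the remaining
   negative term is dropped. *)
have f_le : \sum_x `|f x| ^+ 2 <= (q ^ 4 * #|A|)%:R.
  have -> : \sum_x `|f x| ^+ 2 = \sum_x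
      ((q ^ 4)%:R * (x \in A)%:R - #|A|%:R * ((q ^ 2)%:R * (x \in A)%:R)
       - #|A|%:R * f x).
    apply: eq_bigr => x _; rewrite real_normK ?rpredB ?rpredM ?realn // /f.
    by rewrite (expnM q 2 2) natrX; case: (x \in A) => /=; ring.
  rewrite !sumrB -!mulr_sumr sum_f sum_ind mulr0 subr0 -!natrM.
  by rewrite lerBlDr lerDl ler0n.
have -> : \sum_(g in SO2 q) \sum_z `|\sum_y f (g *m y + z) * h y| ^+ 2
    = (\sum_(m in rigid_motions q) excess A B m ^+ 2)%:~R.
  rewrite rmorph_sum /= pair_big_dep /=; apply: eq_big => [[g z]|[g z] _] /=.
    by rewrite !inE andbT.
  have -> : \sum_y f (g *m y + z) * h y = (excess A B (g, z))%:~R.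
    rewrite /excess rmorphB /= !rmorph_nat !natrM /motion_hits -!sum_ind.
    rewrite !mulr_sumr -sumrB; apply: eq_bigr => y _.
    rewrite inE sum_ind /f /h.
    by case: (y \in B); case: (_ \in A) => /=; ring.
  by rewrite real_normK ?realz // rmorphXn.
rewrite -(ler_int algC) rmorph_nat => /le_trans; apply.
have -> : (q ^ 6 * p ^ r.-1 * (#|A| * #|B|))%:R
    = (q ^ 2 * p ^ r.-1)%:R * (q ^ 4 * #|A|)%:R * #|B|%:R :> algC.
  by rewrite (expnD q 2 4) !natrM; ring.
by apply: ler_wpM2r => //; apply: ler_wpM2l.
Qed.

(** After Cauchy-Schwarz over [M], the sum of squares only grows when extended to all rigid motions.
    Squaring and clearing denominators keep the estimate in [int]. *)
Lemma incidences_sqr_le (A B : {set V}) (M : {set 'M['Z_q]_2 * V}) :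
    M \subset rigid_motions q ->
  ((q ^ 2 * incidences (setX A B) M)%:R - (#|A| * #|B| * #|M|)%:R) ^+ 2
    <= (q ^ 6 * p ^ r.-1 * (#|A| * #|B| * #|M|))%:R :> int.
Proof.
move=> MG.
have -> : (q ^ 2 * incidences (setX A B) M)%:R - (#|A| * #|B| * #|M|)%:R
    = \sum_(m in M) excess A B m.
  rewrite sumrB sumr_const -[in RHS]natr_sum -[in RHS]big_distrr /=.
  by rewrite -incidences_sum -mulrnA.
apply: le_trans (sqr_sum_le_card _ _) _.
rewrite mulnA natrM mulrC ler_wpM2r //.
apply: le_trans (sum_excess_sqr_le A B).
rewrite [leRHS](big_setID M) /= (setIidPr MG) lerDl.
by apply: sumr_ge0 => i _; exact: sqr_ge0.
Qed.

End Incidences.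

Theorem theorem3p1 (R : realType) :
  exists2 C : R, 0 < C &
    forall (p r : nat), prime p -> odd p -> (1 <= r)%N ->
    forall (A B : {set 'cV['Z_(p ^ r)]_2})
           (M : {set 'M['Z_(p ^ r)]_2 * 'cV['Z_(p ^ r)]_2}),
    M \subset rigid_motions (p ^ r) ->
    let P := setX A B in
    `|(incidences P M)%:R - #|P|%:R * #|M|%:R / p%:R ^+ (2 * r)|
      <= C * (p%:R `^ ((3 * r%:R - 1) / 2)
              * #|P|%:R `^ (1 / 2) * #|M|%:R `^ (1 / 2)).
Proof.
exists 1 => // p r p_prime p_odd r_gt0 A B M MG.
set P := setX A B; rewrite /= mul1r.
have p_gt0 : 0 < p%:R :> R by rewrite ltr0n prime_gt0.
have powR_half_sqr (x y : R) : 0 <= x -> (x `^ (y / 2)) ^+ 2 = x `^ y.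
  by move=> x_ge0; rewrite -powR_mulrn ?powR_ge0 // -powRrM divfK ?pnatr_eq0.
rewrite -ler_sqr ?nnegrE ?mulr_ge0 ?powR_ge0 //.
rewrite real_normK ?num_real // !exprMn !powR_half_sqr ?ler0n //.
rewrite !powRr1 ?ler0n //.
(* The squared target carries [p ^ (3 * r - 1)], split as [q * q * p ^ r.-1] to match the integer
   bound. *)
have -> : 3 * r%:R - 1 = (r + r + r.-1)%:R :> R.
  by rewrite !natrD -subn1 natrB //; ring.
rewrite powR_mulrn ?ler0n // [(2 * r)%N]mulnC exprM !exprD.
have := incidences_sqr_le p_prime p_odd r_gt0 A B MG.
rewrite -(ler_int R) rmorphXn rmorphB /= !rmorph_nat -/P -cardsX.
rewrite -/P !natrM !natrX.
have q_neq0 : p%:R ^+ r != 0 :> R by rewrite expf_neq0 ?gt_eqF.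
move: (p%:R ^+ r) (p%:R ^+ r.-1) q_neq0 (incidences P M)%:R (#|P|%:R) (#|M|%:R).
move=> q s q_neq0 i a b le_qi.
have q4_gt0 : 0 < q ^+ 4 by rewrite exprn_even_gt0.
(* Multiplying by [q ^+ 4] clears the squared denominator [q ^+ 2] and turns [q * q] on the right
   into the sixth power of the integer bound. *)
rewrite -(ler_pM2l q4_gt0).
have -> : q ^+ 4 * (i - a * b / q ^+ 2) ^+ 2 = (q * q * i - a * b) ^+ 2.
  by field.
by apply: le_trans le_qi _; rewrite le_eqVlt; apply/orP; left; apply/eqP; ring.
Qed.
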